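(* Let $\mathcal{X},\mathcal{A}$ be finite sets, let $P_{A|X}$ be a channel from $\mathcal{X}$ to $\mathcal{A}$, and for each $n\ge 1$ let $P^{\times n}_{XAB}$ be the distribution on $\mathcal{X}^n\times\mathcal{A}^n\times\mathcal{A}^n$ given by $P^{\times n}_{XAB}(x^n,a^n,b^n)=|\mathcal{X}|^{-n}\prod_{i=1}^n P_{A|X}(a_i|x_i)P_{A|X}(b_i|x_i)$. Then $$\lim_{n\to\infty}\frac{\log \omega_{\mathrm{c}}(n)}{n}=\lim_{n\to\infty}\frac{\log \omega_{\mathrm{q}}(n)}{n}=\lim_{n\to\infty}\frac{\log \omega_{\mathrm{ns}}(n)}{n}=\max_{Q_{XA}}\Big( I(X;A)_Q-2D(Q_{A|X}\,\|\,P_{A|X}\mid Q_X)\Big)-\log|\mathcal{X}|,$$ where the maximum is over all probability distributions $Q_{XA}$ on $\mathcal{X}\times\mathcal{A}$ (in particular, all three limits exist).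
   Context: All logarithms are base $2$. Write $P=P^{\times n}_{XAB}$. The classical value is $\omega_{\mathrm{c}}(n)=\max_{f,g}\sum_{x^n,a^n,b^n}P(x^n,a^n,b^n)\,\delta[f(a^n)=g(b^n)=x^n]$, maximized over all functions $f,g\colon\mathcal{A}^n\to\mathcal{X}^n$ ($\delta$ the indicator). The quantum value is $\omega_{\mathrm{q}}(n)=\sup_{d\ge1}\sup_{\sigma,M,N}\sum_{x^n,a^n,b^n}P(x^n,a^n,b^n)\operatorname{tr}[\sigma(M_{x^n}(a^n)\otimes N_{x^n}(b^n))]$, where $\sigma$ ranges over density matrices on $\mathbb{C}^d\otimes\mathbb{C}^d$ and, for each $a^n$ (resp. $b^n$), $\{M_{x^n}(a^n)\}_{x^n\in\mathcal{X}^n}$ (resp. $\{N_{x^n}(b^n)\}$) is a POVM on $\mathbb{C}^d$. The no-signalling value is $\omega_{\mathrm{ns}}(n)=\sup_{Q}\sum P(x^n,a^n,b^n)Q(x^n,x^n|a^n,b^n)$ over all conditional distributions $Q(y,z|a^n,b^n)$ on $\mathcal{X}^n\times\mathcal{X}^n$ given $(a^n,b^n)\in\mathcal{A}^n\times\mathcal{A}^n$ that are no-signalling: $\sum_{y}Q(y,z|a^n,b^n)$ does not depend on $a^n$ and $\sum_{z}Q(y,z|a^n,b^n)$ does not depend on $b^n$. For a distribution $Q_{XA}$: $I(X;A)_Q=H(X)_Q+H(A)_Q-H(X,A)_Q$ with Shannon entropies $H$; $D(P\|Q)=\sum_x P(x)\log\frac{P(x)}{Q(x)}$; and $D(Q_{A|X}\|P_{A|X}\mid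 Q_X)=\sum_x Q_X(x)D(Q_{A|X=x}\|P_{A|X=x})$. *)

(* Defs.v *)
From HB Require Import structures.
From mathcomp Require Import all_boot all_order all_algebra.
From mathcomp Require Import all_classical all_reals.
From mathcomp Require Import topology normedtype sequences exp.
From mathcomp Require Import complex mxtens.

Set Implicit Arguments.
Unset Strict Implicit.
Unset Printing Implicit Defensive.

Import Order.TTheory GRing.Theory Num.Theory.
Local Open Scope ring_scope.

Section Defs.
Variables (R : realType) (X A : finType).

Definition log2 (x : R) : R := ln x / ln 2.

Definition seqn (T : finType) (n : nat) := {ffun 'I_n -> T}.

Definition is_channel (W : X -> A -> R) : Prop :=
  (forall x a, 0 <= W x a) /\ (forall x, \sum_(a : A) W x a = 1).

Definition is_dist_XA (Q : X -> A -> R) : Prop :=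
  (forall x a, 0 <= Q x a) /\ \sum_(x : X) \sum_(a : A) Q x a = 1.

Variable W : X -> A -> R.

Definition Pn (n : nat) (x : seqn X n) (a b : seqn A n) : R :=
  (#|X|%:R ^- n) * \prod_(i < n) (W (x i) (a i) * W (x i) (b i)).

Definition omega_c (n : nat) : R :=
  \big[Num.max/0]_(f : {ffun seqn A n -> seqn X n})
   \big[Num.max/0]_(g : {ffun seqn A n -> seqn X n})
     \sum_(x : seqn X n) \sum_(a : seqn A n) \sum_(b : seqn A n)
        Pn x a b * ((f a == x) && (g b == x))%:R.

Local Notation C := (R[i]).

Definition adjmx {m k : nat} (M : 'M[C]_(m, k)) : 'M[C]_(k, m) :=
  (map_mx (@conjc R) M)^T.

Definition psdmx {k : nat} (M : 'M[C]_k) : Prop :=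
  adjmx M = M /\ forall v : 'cV[C]_k, 0 <= (adjmx v *m M *m v) 0 0.

Definition density {k : nat} (S : 'M[C]_k) : Prop :=
  psdmx S /\ \tr S = 1.

Definition povm {k : nat} (T : finType) (M : T -> 'M[C]_k) : Prop :=
  (forall t, psdmx (M t)) /\ \sum_(t : T) M t = 1%:M.

Definition qvalue (n d : nat) (S : 'M[C]_(d * d))
  (M N : seqn A n -> seqn X n -> 'M[C]_d) : R :=
  \sum_(x : seqn X n) \sum_(a : seqn A n) \sum_(b : seqn A n)
     Pn x a b * complex.Re (\tr (S *m (M a x *t N b x))).

Definition omega_q (n : nat) : R :=
  sup [set v : R | exists (d : nat) (S : 'M[C]_(d.+1 * d.+1))
                      (M N : seqn A n -> seqn X n -> 'M[C]_(d.+1)),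
          [/\ density S, (forall a, povm (M a)), (forall b, povm (N b))
            & v = qvalue S M N]]%classic.

(* no-signalling value; Q a b y z = Q(y,z | a^n, b^n) *)
Definition no_signalling (n : nat)
  (Q : seqn A n -> seqn A n -> seqn X n -> seqn X n -> R) : Prop :=
  [/\ (forall a b y z, 0 <= Q a b y z),
      (forall a b, \sum_(y : seqn X n) \sum_(z : seqn X n) Q a b y z = 1),
      (forall a a' b z, \sum_(y : seqn X n) Q a b y z = \sum_(y : seqn X n) Q a' b y z)
    & (forall a b b' y, \sum_(z : seqn X n) Q a b y z = \sum_(z : seqn X n) Q a b' y z)].

Definition omega_ns (n : nat) : R :=
  sup [set v : R | exists Q, no_signalling Q /\
         v = \sum_(x : seqn X n) \sum_(a : seqn A n) \sum_(b : seqn A n)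
                Pn x a b * Q a b x x]%classic.

Definition xlog2x (t : R) : R := if t == 0 then 0 else t * log2 t.

Definition entropy (T : finType) (p : T -> R) : R := - \sum_(t : T) xlog2x (p t).

Definition margX (Q : X -> A -> R) (x : X) : R := \sum_(a : A) Q x a.
Definition margA (Q : X -> A -> R) (a : A) : R := \sum_(x : X) Q x a.

Definition mutual_info (Q : X -> A -> R) : R :=
  entropy (margX Q) + entropy (margA Q)
  - entropy (fun xa : X * A => Q xa.1 xa.2).

(* D(Q_{A|X} || P_{A|X} | Q_X) = sum_x Q_X(x) sum_a Q(a|x) log (Q(a|x)/W(a|x))
   = sum_{x,a} Q(x,a) log (Q(x,a) / (Q_X(x) W(x,a))), +oo if not abs. continuous *)
Definition cond_div (Q : X -> A -> R) : \bar R :=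
  (\sum_(x : X) \sum_(a : A)
     (if (Q x a == 0)%R then 0%E
      else if (W x a == 0)%R then +oo%E
      else ((Q x a * log2 (Q x a / (margX Q x * W x a)))%R)%:E))%E.

Definition objective (Q : X -> A -> R) : \bar R :=
  ((mutual_info Q - log2 #|X|%:R)%:E - 2%:E * cond_div Q)%E.

End Defs.

(* Main.v *)
Require Import Defs.
From HB Require Import structures.
From mathcomp Require Import all_boot all_order all_algebra.
From mathcomp Require Import all_classical all_reals.
From mathcomp Require Import topology normedtype sequences exp derive realfun.
From mathcomp Require Import spectral complex mxtens.
From mathcomp Require Import ring lra.

(** The limit is [log K - log #|X|], where [log K] is the Renyi capacity of order
  2 of the channel [W]. Maximizing [sum_a sqrt (sum_x p x * W x a ^ 2)] over the
  simplex and reading off the first order conditions gives distributions [p], [q]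
  with [sum_a W x a ^ 2 / q a <= K] for all [x], with equality where [p x != 0], and
  [sum_x p x * W x a ^ 2 = K * q a ^ 2]. The joint law [p x * W x a ^ 2 / (q a * K)]
  then has marginals [p], [q] and maximizes the single-letter objective.

  Upper bound: a no-signalling [Q(x,x|a,b)] is at most each of its marginals; after
  AM-GM on [W x a * W x b], weighted by the product of the [q]'s, this alone bounds
  the value by [(K / #|X|) ^ n].

  Lower bound: if both players use the same decoder with cells [D_x], the value is
  [#|X|^-n * sum_x W (D_x | x) ^ 2]. With [V := W ^ 2 / (q K)] one has
  [(V / q) * (W / V) ^ 2 = K] exactly, so a maximal code for [V] built from pairs
  whose information density [log (V / q)] lies in one of finitely many windows of
  width [n * eps] is good enough, whichever window it is. By pigeonhole
  some window has probability bounded below independently of [n]. *)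

Set Implicit Arguments.
Unset Strict Implicit.
Unset Printing Implicit Defensive.

Import Order.TTheory GRing.Theory Num.Theory numFieldNormedType.Exports.
Local Open Scope classical_set_scope.
Local Open Scope ring_scope.

(* [mathcomp.boot.seq] exports another [seqn]. *)
Local Notation seqn := Defs.seqn.

(** * One-shot bounds *)

(** Once [P a b x] is replaced by [r b x], the sum over [a] separates and is at most [K]; what is
    left is a [q]-average of the masses [\sum_x r b x]. *)
Lemma weighted_diag_le (R : realFieldType) (X A : finType) (W : X -> A -> R)
    (q : A -> R) (K : R) (P : A -> A -> X -> R) (r : A -> X -> R) :
  0 <= K -> (forall a, 0 <= q a) -> \sum_a q a = 1 ->
  (forall x, \sum_a W x a ^+ 2 / q a <= K) ->
  (forall a b x, 0 <= P a b x <= r b x) -> (forall b, \sum_x r b x <= 1) ->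
  \sum_x \sum_a \sum_b W x a ^+ 2 / q a * q b * P a b x <= K.
Proof.
move=> K0 q0 q1 WK Pr r1.
have r0 b x : 0 <= r b x by have /andP[h1 h2] := Pr b b x; exact: le_trans h2.
apply: (@le_trans _ _ (\sum_x \sum_b K * (q b * r b x))).
  apply: ler_sum => x _.
  rewrite exchange_big /=; apply: ler_sum => b _.
  apply: (@le_trans _ _ ((\sum_a W x a ^+ 2 / q a) * (q b * r b x))).
    rewrite mulr_suml; apply: ler_sum => a _.
    rewrite -mulrA ler_wpM2l ?divr_ge0 ?sqr_ge0 //.
    by rewrite ler_wpM2l //; have /andP[] := Pr a b x.
  by rewrite ler_wpM2r // mulr_ge0.
rewrite exchange_big /=.
under eq_bigr do rewrite -mulr_sumr -mulr_sumr.
rewrite -mulr_sumr -[leRHS]mulr1 ler_wpM2l //.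
rewrite -[leRHS]q1; apply: ler_sum => b _.
by rewrite -[leRHS]mulr1 ler_wpM2l.
Qed.

(* AM-GM: [W_a W_b <= (W_a^2 q_b / q_a + W_b^2 q_a / q_b) / 2]. In the first term
   [P a b x] is then replaced by [r2 b x], which leaves the sum over [a] free to be
   bounded by [K]; in the second term by [r1 a x]. *)
Lemma diag_value_le (R : realFieldType) (X A : finType) (W : X -> A -> R)
    (q : A -> R) (K : R) (P : A -> A -> X -> R) (r1 r2 : A -> X -> R) :
  0 <= K ->
  (forall x a, 0 <= W x a) ->
  (forall a, 0 <= q a) -> \sum_a q a = 1 ->
  (forall x a, q a = 0 -> W x a = 0) ->
  (forall x, \sum_a W x a ^+ 2 / q a <= K) ->
  (forall a b x, [/\ 0 <= P a b x, P a b x <= r1 a x & P a b x <= r2 b x]) ->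
  (forall a, \sum_x r1 a x <= 1) -> (forall b, \sum_x r2 b x <= 1) ->
  \sum_x \sum_a \sum_b W x a * W x b * P a b x <= K.
Proof.
move=> K0 W0 q0 q1 qW WK HP h1 h2.
have S2 : \sum_x \sum_a \sum_b W x a ^+ 2 / q a * q b * P a b x <= K.
  apply: (@weighted_diag_le _ _ _ _ _ _ _ r2) => // a b x.
  by have [-> _ ->] := HP a b x.
have S1 : \sum_x \sum_a \sum_b W x a ^+ 2 / q a * q b * P b a x <= K.
  apply: (@weighted_diag_le _ _ _ _ _ _ (fun a b x => P b a x) r1) => // a b x.
  by have [-> -> _] := HP b a x.
have {}S1 : \sum_x \sum_a \sum_b W x b ^+ 2 / q b * q a * P a b x <= K.
  apply: le_trans S1; apply: ler_sum => x _; rewrite exchange_big /=.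
  by apply: ler_sum => a _; apply: ler_sum => b _.
rewrite -(ler_pM2l (x := 2%:R)) ?ltr0n // mulr_natl [leRHS]mulr_natl !mulr2n.
apply: le_trans (lerD S2 S1).
rewrite -!big_split; apply: ler_sum => x _.
rewrite -!big_split; apply: ler_sum => a _.
rewrite -!big_split; apply: ler_sum => b _ /=.
rewrite -[X in X <= _]mulrDl -[X in _ <= X]mulrDl ler_wpM2r //; first by have [] := HP a b x.
have [qa|qa] := eqVneq (q a) 0.
  by rewrite (qW x a qa) mul0r add0r addr_ge0 // mulr_ge0 // divr_ge0 // sqr_ge0.
have [qb|qb] := eqVneq (q b) 0.
  by rewrite (qW x b qb) mulr0 add0r addr_ge0 // mulr_ge0 // divr_ge0 // sqr_ge0.
rewrite -subr_ge0.
have -> : W x a ^+ 2 / q a * q b + W x b ^+ 2 / q b * q a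
   - (W x a * W x b + W x a * W x b)
   = (W x a * q b - W x b * q a) ^+ 2 / (q a * q b).
  by field; rewrite qa qb.
by rewrite divr_ge0 ?sqr_ge0 // mulr_ge0.
Qed.

(* Feinstein's maximal code argument: take a partial decoder [f] all of whose
   nonempty cells [D_x] lie in [G] and satisfy [V (D_x | x) >= gam / 2], with the
   largest possible domain. *)
Lemma maximal_code (R : realFieldType) (X A : finType) (x0 : X) (p : X -> R)
    (V W : X -> A -> R) (q : A -> R) (G : X -> A -> bool) (theta tau gam : R) :
  (forall x, 0 <= p x) -> \sum_x p x = 1 ->
  (forall x a, 0 <= V x a) -> (forall x, \sum_a V x a <= 1) ->
  (forall x a, 0 <= W x a) ->
  (forall a, \sum_x p x * V x a <= q a) ->
  0 < theta -> 0 <= tau -> 0 < gam -> gam <= 1 ->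
  (forall x a, G x a -> q a <= theta * V x a) ->
  (forall x a, G x a -> tau * V x a <= W x a) ->
  gam <= \sum_x \sum_(a | G x a) p x * V x a ->
  exists f : {ffun A -> X},
    tau ^+ 2 * gam ^+ 3 / (8 * theta) <= \sum_x (\sum_(a | f a == x) W x a) ^+ 2.
Proof.
move=> p0 p1 V0 V1 W0 pVq th0 ta0 ga0 ga1 Gq GW Ggam.
pose lam := gam / 2.
have lam0 : 0 < lam by rewrite /lam; lra.
have lam1 : lam <= 1 by rewrite /lam; lra.
pose D (f : {ffun A -> option X}) x := \sum_(a | f a == Some x) V x a.
pose valid (f : {ffun A -> option X}) :=
  [forall a, forall x, (f a == Some x) ==> G x a] &&
  [forall x, (lam <= D f x) || [forall a, f a != Some x]].
have valid0 : valid [ffun => None].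
  apply/andP; split; [apply/forallP => a|apply/forallP => x].
    by apply/forallP => x; rewrite ffunE.
  by apply/orP; right; apply/forallP => a; rewrite ffunE.
case: (@arg_maxnP _ _ valid (fun f : {ffun A -> option X} => #|[set a | f a != None]%SET|) valid0).
move=> f /andP[/forallP fG /forallP fD] fmax.
have {}fG a x : f a = Some x -> G x a.
  by move=> fa; have /forallP /(_ x) := fG a; rewrite fa eqxx.
(* If [x] owns a cell, that cell alone has mass at least [lam]. Otherwise the part of [G x] outside
   the domain of [f] has mass below [lam], since a heavier part could be added as a new cell. *)
have key x : lam * (\sum_(a | G x a) V x a - lam) <= \sum_(a | f a != None) V x a.
  have u0 : 0 <= \sum_(a | f a != None) V x a by exact: sumr_ge0.
  have v0 : 0 <= \sum_(a | G x a) V x a by exact: sumr_ge0.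
  have v1 : \sum_(a | G x a) V x a <= 1.
    apply: le_trans (V1 x); rewrite [leRHS](bigID (G x)) /= lerDl.
    exact: sumr_ge0.
  have [/forallP fx|/forallPn[a1]] := boolP [forall a, f a != Some x]; last first.
    rewrite negbK => fa1.
    have /orP[Dx|/forallP /(_ a1)] := fD x; last by rewrite fa1.
    have : D f x <= \sum_(a | f a != None) V x a.
      rewrite /D [leRHS](bigID (fun a => f a == Some x)) /=.
      rewrite [X in _ <= X + _](eq_bigl (fun a => f a == Some x)); last first.
        by move=> a; case: (f a).
      by rewrite lerDl; exact: sumr_ge0.
    by nra.
  pose r := \sum_(a | G x a && (f a == None)) V x a.
  have vur : \sum_(a | G x a) V x a <= \sum_(a | f a != None) V x a + r.
    rewrite [leLHS](bigID (fun a => f a == None)) /= addrC lerD2r.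
    rewrite [leRHS](bigID (G x)) /= [X in X <= _](eq_bigl (fun a => (f a != None) && G x a)); last first.
      by move=> a; rewrite andbC.
    by rewrite lerDl; exact: sumr_ge0.
  have [rlam|rlam] := ltP r lam.
    have [?|?] := leP lam (\sum_(a | G x a) V x a); nra.
  exfalso.
  pose f' := [ffun a => if (f a == None) && G x a then Some x else f a].
  have f'x a : (f' a == Some x) = G x a && (f a == None).
    rewrite ffunE andbC; case: ifP => _; first by rewrite eqxx.
    exact/negbTE/fx.
  have f'y a y : y != x -> (f' a == Some y) = (f a == Some y).
    move=> yx; rewrite ffunE; case: ifP => // /andP[/eqP -> _].
    by apply/negbTE; apply: contraNneq yx => -[->].
  have valid' : valid f'.
    apply/andP; split; [apply/forallP => a|apply/forallP => y].
      apply/forallP => y; apply/implyP => /eqP.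
      rewrite ffunE; case: ifP => [/andP[_ Gx] [<-] //|_]; exact: fG.
    have [->|yx] := eqVneq y x.
      by rewrite /D (eq_bigl _ _ f'x) rlam.
    have := fD y; rewrite /D (eq_bigl _ _ (fun a => f'y a y yx)) => /orP[-> //|/forallP h].
    by apply/orP; right; apply/forallP => a; rewrite f'y.
  have := fmax _ valid'; rewrite /geq /= leqNgt => /negP; apply; apply: proper_card.
  (* Since [lam > 0], the new cell is nonempty and the domain grows strictly. *)
  have [a1 Ha1] : exists a, G x a && (f a == None).
    case: (pickP (fun a => G x a && (f a == None))) => [a Ha|h]; first by exists a.
    by move: rlam; rewrite /r (eq_bigl _ _ h) big_pred0_eq leNgt lam0.
  apply/properP; split.
    apply/fintype.subsetP => a; rewrite !inE ffunE => fa.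
    by case: ifP.
  exists a1; rewrite !inE.
    by rewrite ffunE andbC Ha1.
  by rewrite negbK; case/andP: Ha1.
(* Average [key] over [p]. The left side is at least [lam * (gam - lam) = lam ^ 2]; on the right,
   [p V] averages to at most [q], and [q <= theta * V] on the cells because they lie in [G]. *)
have total : lam ^+ 2 <= theta * \sum_x D f x.
  apply: (@le_trans _ _ (\sum_x p x * (lam * (\sum_(a | G x a) V x a - lam)))).
    under eq_bigr do rewrite mulrCA mulrBr mulr_sumr.
    rewrite -mulr_sumr sumrB -mulr_suml p1 mul1r.
    rewrite expr2 ler_pM2l //.
    by rewrite lerBrDr; apply: le_trans Ggam; rewrite /lam; lra.
  apply: (@le_trans _ _ (\sum_x p x * \sum_(a | f a != None) V x a)).
    by apply: ler_sum => x _; rewrite ler_wpM2l.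
  apply: (@le_trans _ _ (\sum_(a | f a != None) q a)).
    under eq_bigr do rewrite mulr_sumr.
    by rewrite exchange_big /=; apply: ler_sum => a _.
  apply: (@le_trans _ _ (\sum_x \sum_(a | f a == Some x) q a)).
    rewrite (exchange_big_dep (fun a => f a != None)) /=; last by move=> x a _ /eqP ->.
    apply: ler_sum => a; case fa : (f a) => [x|] // _.
    by rewrite (big_pred1 x) // => y; rewrite /= (inj_eq (@Some_inj _)) eq_sym.
  rewrite mulr_sumr; apply: ler_sum => x _.
  rewrite /D mulr_sumr; apply: ler_sum => a /eqP fa.
  by apply: Gq; exact: fG.
have D0 x : 0 <= D f x by exact: sumr_ge0.
(* Undecoded outputs are sent to [x0], which can only enlarge a cell. *)
exists [ffun a => odflt x0 (f a)].
(* A cell is empty or satisfies [D f x >= lam]; either way [D f x ^ 2 >= lam * D f x]. *)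
apply: (@le_trans _ _ (\sum_x tau ^+ 2 * (lam * D f x))); last first.
  apply: ler_sum => x _.
  apply: (@le_trans _ _ ((tau * D f x) ^+ 2)).
    rewrite exprMn ler_wpM2l ?sqr_ge0 //.
    have /orP[Dx|/forallP h] := fD x; first by rewrite expr2 ler_wpM2r.
    by rewrite /D big_pred0 ?mulr0 ?expr0n //= => a; apply/negbTE.
  rewrite ler_sqr ?nnegrE; last 2 first.
  - by rewrite mulr_ge0.
  - by exact: sumr_ge0.
  apply: (@le_trans _ _ (\sum_(a | f a == Some x) W x a)).
    rewrite /D mulr_sumr; apply: ler_sum => a /eqP fa.
    by apply: GW; exact: fG.
  rewrite [leRHS](bigID (fun a => f a == Some x)) /=.
  rewrite [X in X <= _](eq_bigl (fun a => ([ffun a => odflt x0 (f a)] a == x) && (f a == Some x))).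
    by rewrite lerDl; exact: sumr_ge0.
  by move=> a; rewrite ffunE; case fa : (f a) => [y|]; rewrite ?andbF //= (inj_eq (@Some_inj _)) andbb.
rewrite -!mulr_sumr -mulrA ler_wpM2l ?sqr_ge0 //.
rewrite ler_pdivrMr ?mulr_gt0 //.
have -> : gam = 2 * lam by rewrite /lam; lra.
move: total; set S := \sum_x D f x => total.
have -> : (2 * lam) ^+ 3 = 8 * lam * lam ^+ 2 by ring.
have -> : lam * S * (8 * theta) = 8 * lam * (theta * S) by ring.
by rewrite ler_wpM2l // mulr_ge0 // ltW.
Qed.

(** * The optimal input distribution *)

Lemma cvg_sumr (R : realType) (T : Type) (F : set_system T) (I : finType)
    (f : I -> T -> R) (l : I -> R) : Filter F ->
  (forall i, f i x @[x --> F] --> l i) ->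
  (\sum_i f i x) @[x --> F] --> \sum_i l i.
Proof.
move=> FF fl.
apply: (@cvg_big R I +%R 0 xpredT (@add_continuous R) T F (index_enum I) f l FF) => i _.
exact: fl.
Qed.

(** Multiplying by the conjugate exposes the factor [t], so the difference quotient can be evaluated
    at [t = 0] by substitution. If the denominator vanishes, so do both roots. *)
Lemma sqrtr_subE (R : rcfType) (s w t : R) :
  0 <= s -> 0 <= w -> 0 < t -> t <= 1 ->
  Num.sqrt ((1 - t) * s + t * w) - Num.sqrt s =
  t * ((w - s) / (Num.sqrt ((1 - t) * s + t * w) + Num.sqrt s)).
Proof.
move=> s0 w0 t0 t1; set u := (1 - t) * s + t * w.
have u0 : 0 <= u by rewrite addr_ge0 // mulr_ge0 ?subr_ge0 // ltW.
have [d0|d0] := eqVneq (Num.sqrt u + Num.sqrt s) 0.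
  move/eqP: d0; rewrite paddr_eq0 ?sqrtr_ge0 // => /andP[/eqP -> /eqP ->].
  by rewrite addr0 invr0 !mulr0 subrr.
apply: (mulIf d0).
rewrite mulrA divfK //.
have -> : (Num.sqrt u - Num.sqrt s) * (Num.sqrt u + Num.sqrt s)
  = Num.sqrt u ^+ 2 - Num.sqrt s ^+ 2 by ring.
by rewrite !sqr_sqrtr // /u; ring.
Qed.

(** First order condition at [s] in the direction of [w]: the difference quotients [\sum_a D t a]
    are nonpositive, and their limit at 0 is half of [\sum_a (w a - s a) / sqrt (s a)]. *)
Lemma sum_sqrt_kkt (R : realType) (A : finType) (s w : A -> R) :
  (forall a, 0 <= s a) -> (forall a, 0 <= w a) ->
  (forall t, 0 < t -> t <= 1 ->
     \sum_a Num.sqrt ((1 - t) * s a + t * w a) <= \sum_a Num.sqrt (s a)) ->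
  (forall a, s a = 0 -> w a = 0) /\
  \sum_a w a / Num.sqrt (s a) <= \sum_a Num.sqrt (s a).
Proof.
move=> s0 w0 smax.
pose u t a := (1 - t) * s a + t * w a.
pose D t a := (w a - s a) / (Num.sqrt (u t a) + Num.sqrt (s a)).
have Dle t : 0 < t -> t <= 1 -> \sum_a D t a <= 0.
  move=> t0 t1; have := smax t t0 t1.
  rewrite -subr_le0 -sumrB (eq_bigr (fun a => t * D t a)).
    by rewrite -mulr_sumr pmulr_rle0.
  by move=> a _; rewrite /D /u sqrtr_subE.
(* A bound uniform in [t], so that the other terms cannot compensate for one that blows up. *)
have Dge t a : 0 < t -> t <= 1 -> - Num.sqrt (s a) <= D t a.
  move=> t0 t1; have [sa|sa] := eqVneq (s a) 0.
    by rewrite /D sa sqrtr0 subr0 oppr0 addr0 divr_ge0 // sqrtr_ge0.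
  have sp : 0 < Num.sqrt (s a) by rewrite sqrtr_gt0 lt_def sa s0.
  have dp : 0 < Num.sqrt (u t a) + Num.sqrt (s a).
    by rewrite ltr_wpDl // sqrtr_ge0.
  rewrite /D ler_pdivlMr // mulNr lerNl opprB.
  rewrite mulrDr -expr2 sqr_sqrtr //.
  rewrite lerBlDr -addrA addrC -addrA lerDl.
  by rewrite addr_ge0 // mulr_ge0 ?sqrtr_ge0.
(* Otherwise the term of [a] in the difference quotient is [sqrt (w a / t)],
   unbounded as [t] tends to [0]. *)
have sw a : s a = 0 -> w a = 0.
  move=> sa; apply/eqP; rewrite eq_le w0 andbT leNgt; apply/negP => wa.
  pose g := \sum_a Num.sqrt (s a).
  have g0 : 0 <= g by apply: sumr_ge0 => b _; exact: sqrtr_ge0.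
  have c0 : 0 < w a + (g + 1) ^+ 2 by rewrite ltr_wpDr // sqr_ge0.
  (* With this [t] the term of [a] equals [sqrt (w a + (g + 1) ^ 2) >= g + 1], while the other terms
     sum to at least [- g]. *)
  pose t := w a / (w a + (g + 1) ^+ 2).
  have t0 : 0 < t by rewrite divr_gt0.
  have t1 : t <= 1 by rewrite ler_pdivrMr // mul1r lerDl sqr_ge0.
  have := Dle t t0 t1; rewrite (bigD1 a) //= leNgt => /negP; apply.
  have h : - g <= \sum_(b | b != a) D t b.
    rewrite /g (bigD1 a) //= sa sqrtr0 add0r -sumrN.
    by apply: ler_sum => b _; exact: Dge.
  have -> : D t a = Num.sqrt (w a + (g + 1) ^+ 2).
    rewrite /D /u sa sqrtr0 mulr0 add0r addr0 subr0.
    have -> : t * w a = (w a) ^+ 2 / (w a + (g + 1) ^+ 2) by rewrite /t; ring.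
    rewrite sqrtrM ?sqr_ge0 // sqrtr_sqr ger0_norm // sqrtrV ?ltW //.
    by rewrite invfM invrK mulrA divff ?mul1r // gt_eqF.
  have : g + 1 <= Num.sqrt (w a + (g + 1) ^+ 2).
    rewrite -[leLHS]ger0_norm; last by rewrite addr_ge0.
    by rewrite -sqrtr_sqr ler_sqrt ?lerDr // ltW.
  by move: h; lra.
split => //.
have D0 : \sum_a D 0 a <= 0.
  apply: (@cvgr_to_le R (0 : R)^'+ _ R (fun t => \sum_a D t a)); last first.
    by near=> t; apply: Dle => //; near: t; apply: nbhs_right_le; rewrite ltr01.
    apply: (@cvg_sumr R _ (0:R)^'+ A (fun a t => D t a) (D 0) _) => a.
  apply: cvg_at_right_filter.
  have [sa|sa] := eqVneq (s a) 0.
    rewrite /D sa (sw _ sa) subrr; under eq_fun do rewrite mul0r.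
    rewrite mul0r; exact: cvg_cst.
  apply: cvgM; first exact: cvg_cst.
  apply: cvgV.
    by rewrite gt_eqF // ltr_wpDl ?sqrtr_ge0 // sqrtr_gt0 lt_def sa s0.
  apply: cvgD; last exact: cvg_cst.
  apply: (@cvg_comp _ _ _ (fun t => u t a) Num.sqrt _ (nbhs (u 0 a))).
    apply: cvgD; (apply: cvgM; last exact: cvg_cst); last exact: cvg_id.
    by apply: cvgB; [exact: cvg_cst|exact: cvg_id].
  exact: sqrt_continuous.
rewrite -subr_le0 -sumrB.
apply: le_trans (_ : 2 * \sum_a D 0 a <= 0); last by lra.
rewrite mulr_sumr; apply: ler_sum => a _.
rewrite /D /u subr0 mul1r mul0r addr0.
have [sa|sa] := eqVneq (s a) 0.
  by rewrite sa (sw _ sa) !subr0 !mul0r sqrtr0 subr0 mulr0.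
have sp : 0 < Num.sqrt (s a) by rewrite sqrtr_gt0 lt_def sa s0.
move: (Num.sqrt (s a)) sp (sqr_sqrtr (s0 a)) => r r0 <-.
rewrite le_eqVlt; apply/orP; left; apply/eqP.
by field; rewrite !gt_eqF ?addr_gt0.
Unshelve. all: by end_near.
Qed.

(** The simplex is a closed subset of the cube [[0, 1]^X], which is compact by Tychonoff; this is
    why [f] is taken continuous for the pointwise topology. *)
Lemma simplex_max (R : realType) (X : finType) (f : {ptws X -> R} -> R) :
  (0 < #|X|)%N -> continuous f ->
  exists p : X -> R, [/\ (forall x, 0 <= p x), \sum_x p x = 1 &
    forall p' : X -> R, (forall x, 0 <= p' x) -> \sum_x p' x = 1 -> f p' <= f p].
Proof.
move=> /card_gt0P[x0 _] fc.
pose box := [set p : {ptws X -> R} | forall x, (`[0, 1]%classic : set R) (p x)].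
pose hyp := [set p : {ptws X -> R} | \sum_x p x = 1].
have cb : compact box.
  by apply: (@tychonoff X (fun _ => R) (fun _ => `[0, 1]%classic)) => x; exact: segment_compact.
have ch : closed hyp.
  have -> : hyp = (fun p : {ptws X -> R} => \sum_x p x) @^-1` [set 1] by [].
  apply: (proj1 (continuous_closedP _)); last first.
    exact/accessible_closed_set1/hausdorff_accessible/Rhausdorff.
  move=> p; apply: (@cvg_sumr R {ptws X -> R} (nbhs p) X (fun x p => p x) p) => x.
  exact: (@proj_continuous X (fun=> R) x p).
have in_dom p : (forall x, 0 <= p x) -> \sum_x p x = 1 -> p \in box `&` hyp.
  move=> p0 p1; rewrite inE; split => // x; rewrite /= in_itv /= p0 /= -p1.
  by rewrite (bigD1 x) //= lerDl sumr_ge0.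
have ne : box `&` hyp !=set0.
  exists (fun x => (x == x0)%:R); apply/set_mem/in_dom => [x|]; first exact: ler0n.
  rewrite (bigD1 x0) //= eqxx big1 ?addr0 // => x /negbTE ->; exact: erefl.
have [|p] := compact_EVT_max ne (compact_closedI cb ch) (f := f).
  exact: continuous_subspaceT.
rewrite inE => -[pb ph] pmax; exists p; split.
- by move=> x; have := pb x; rewrite /= in_itv => /andP[].
- exact: ph.
- by move=> p' h1 h2; apply: pmax; exact: in_dom.
Qed.

Lemma renyi_optimizer (R : realType) (X A : finType) (W : X -> A -> R) :
  (0 < #|X|)%N -> is_channel W ->
  exists (p : X -> R) (q : A -> R) (K : R),
    [/\ (forall x, 0 <= p x) /\ \sum_x p x = 1,
        (forall a, 0 <= q a) /\ \sum_a q a = 1,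
        0 < K /\ (forall x a, q a = 0 -> W x a = 0),
        forall x, \sum_a W x a ^+ 2 / q a <= K
      & forall a, \sum_x p x * W x a ^+ 2 = K * q a ^+ 2].
Proof.
move=> X0 [W0 W1].
pose s (p : X -> R) a := \sum_x p x * W x a ^+ 2.
have [|p [p0 p1 pmax]] := @simplex_max R X (fun p => \sum_a Num.sqrt (s p a)) X0.
  move=> p; apply: (@cvg_sumr R {ptws X -> R} (nbhs p) A (fun a p => Num.sqrt (s p a))) => a.
  apply: (@cvg_comp _ _ _ (fun p : {ptws X -> R} => s p a) Num.sqrt _ (nbhs (s p a))).
    apply: (@cvg_sumr R {ptws X -> R} (nbhs p) X (fun x p => p x * W x a ^+ 2)) => x.
    apply: cvgM; last exact: cvg_cst.
    exact: (@proj_continuous X (fun=> R) x p).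
  exact: sqrt_continuous.
have s0 a : 0 <= s p a by apply: sumr_ge0 => x _; rewrite mulr_ge0 // sqr_ge0.
have kkt x := @sum_sqrt_kkt R A (s p) (fun a => W x a ^+ 2) s0 (fun a => sqr_ge0 _).
have {}kkt x : (forall a, s p a = 0 -> W x a ^+ 2 = 0) /\
    \sum_a W x a ^+ 2 / Num.sqrt (s p a) <= \sum_a Num.sqrt (s p a).
  apply: kkt => t t0 t1.
  (* Move from [p] towards the point mass at [x]. As [s] is linear in [p], this moves [s p] towards
     [W x ^ 2]. *)
  have := pmax (fun y => (1 - t) * p y + t * (y == x)%:R).
  have h y : 0 <= (1 - t) * p y + t * (y == x)%:R.
    by rewrite addr_ge0 // mulr_ge0 ?subr_ge0 // ltW.
  have sE (F : X -> R) : \sum_y (y == x)%:R * F y = F x.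
    rewrite (bigD1 x) //= eqxx mul1r big1 ?addr0 // => y /negbTE ->; exact: mul0r.
  move=> /(_ h); have -> : \sum_y ((1 - t) * p y + t * (y == x)%:R) = 1.
    rewrite big_split /= -!mulr_sumr p1.
    have := sE (fun => 1); under eq_bigr do rewrite mulr1.
    by move=> ->; ring.
  move=> /(_ erefl); apply: le_trans; rewrite le_eqVlt; apply/orP; left; apply/eqP.
  apply: eq_bigr => a _; congr Num.sqrt.
  rewrite /s; under [RHS]eq_bigr do rewrite mulrDl -!mulrA.
  by rewrite big_split /= -!mulr_sumr sE.
set g := \sum_a Num.sqrt (s p a) in kkt.
(* If [g = 0] then [s p] vanishes, hence so does every row of [W] by [kkt], although rows sum to
   1. *)
have g0 : 0 < g.
  rewrite lt_def sumr_ge0 ?andbT; last by move=> a _; exact: sqrtr_ge0.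
  apply/negP => /eqP g0.
  have sa a : s p a = 0.
    have : Num.sqrt (s p a) = 0.
      by move: g0 => /psumr_eq0P; apply => // b _; exact: sqrtr_ge0.
    by move=> /eqP; rewrite sqrtr_eq0 => ?; apply/eqP; rewrite eq_le s0 andbT.
  have /card_gt0P[x _] := X0.
  have := W1 x; rewrite big1 => [/eqP|a _]; first by rewrite eq_sym oner_eq0.
  by have [/(_ a (sa a)) /eqP + _] := kkt x; rewrite sqrf_eq0 => /eqP.
(* Normalizing [sqrt (s p a)] by [g] and taking [K = g ^ 2] turns the last claim into the definition
   of [s], and the bound in [kkt] into the one by [K]. *)
exists p, (fun a => Num.sqrt (s p a) / g), (g ^+ 2); split => //.
- split; first by move=> a; rewrite divr_ge0 ?sqrtr_ge0 // ltW.
  by rewrite -mulr_suml divff // gt_eqF.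
- split; first by rewrite exprn_gt0.
  move=> x a /eqP; rewrite mulf_eq0 invr_eq0 (gt_eqF g0) orbF sqrtr_eq0 => sa.
  have {}sa : s p a = 0 by apply/eqP; rewrite eq_le s0 andbT.
  by have [/(_ a sa) /eqP + _] := kkt x; rewrite sqrf_eq0 => /eqP.
- move=> x; have [_ h] := kkt x.
  under eq_bigr do rewrite invfM invrK mulrA.
  by rewrite -mulr_suml expr2 ler_pM2r.
- move=> a; rewrite -/(s p a) expr_div_n sqr_sqrtr // mulrC divfK //.
  by rewrite expf_neq0 // gt_eqF.
Qed.

(** * The single-letter objective *)

Lemma xlog2xE (R : realType) (t : R) : xlog2x t = t * log2 t.
Proof. by rewrite /xlog2x; case: eqP => // ->; rewrite mul0r. Qed.

Lemma ln2_gt0 (R : realType) : 0 < ln (2 : R).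
Proof. by rewrite ln_gt0 // ltr1n. Qed.

Lemma log2M (R : realType) (x y : R) : 0 < x -> 0 < y -> log2 (x * y) = log2 x + log2 y.
Proof. by move=> x0 y0; rewrite /log2 lnM ?posrE // mulrDl. Qed.

Lemma log2V (R : realType) (x : R) : 0 < x -> log2 x^-1 = - log2 x.
Proof. by move=> x0; rewrite /log2 lnV ?posrE // mulNr. Qed.

Lemma ln_le_subr1 (R : realType) (x : R) : 0 < x -> ln x <= x - 1.
Proof.
move=> x0; have := @le_ln1Dx R (x - 1).
by rewrite (addrC 1) subrK; apply; lra.
Qed.

Section Objective.
Context (R : realType) (X A : finType) (W : X -> A -> R).
Hypothesis W0 : forall x a, 0 <= W x a.

Lemma margX_gt0 (Q : X -> A -> R) x a :
  (forall x a, 0 <= Q x a) -> Q x a != 0 -> 0 < margX Q x.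
Proof.
move=> Q0 Qxa; apply: (@lt_le_trans _ _ (Q x a)); first by rewrite lt_def Qxa Q0.
by rewrite /margX (bigD1 a) //= lerDl sumr_ge0.
Qed.

Lemma margA_gt0 (Q : X -> A -> R) x a :
  (forall x a, 0 <= Q x a) -> Q x a != 0 -> 0 < margA Q a.
Proof.
move=> Q0 Qxa; apply: (@lt_le_trans _ _ (Q x a)); first by rewrite lt_def Qxa Q0.
by rewrite /margA (bigD1 x) //= lerDl sumr_ge0.
Qed.

Lemma mutual_infoE (Q : X -> A -> R) :
  mutual_info Q =
  \sum_x \sum_a Q x a * (log2 (Q x a) - log2 (margX Q x) - log2 (margA Q a)).
Proof.
under eq_bigr do under eq_bigr do rewrite !mulrBr.
under eq_bigr do rewrite !sumrB.
rewrite !sumrB /mutual_info /entropy.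
have -> : \sum_x xlog2x (margX Q x) = \sum_x \sum_a Q x a * log2 (margX Q x).
  by apply: eq_bigr => x _; rewrite xlog2xE -mulr_suml.
have -> : \sum_a xlog2x (margA Q a) = \sum_x \sum_a Q x a * log2 (margA Q a).
  by rewrite exchange_big; apply: eq_bigr => a _; rewrite xlog2xE -mulr_suml.
have -> : \sum_(t : X * A) xlog2x (Q t.1 t.2) = \sum_x \sum_a Q x a * log2 (Q x a).
  by rewrite pair_bigA; apply: eq_bigr => t _; rewrite xlog2xE.
ring.
Qed.

(** Where [Q x a] is nonzero all the logarithms are of positive reals and split; elsewhere the
    factor [Q x a] removes the term. *)
Lemma objectiveE (Q : X -> A -> R) : (forall x a, 0 <= Q x a) ->
  (forall x a, W x a = 0 -> Q x a = 0) ->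
  objective W Q =
  (\sum_x \sum_a Q x a * (log2 (margX Q x) + 2 * log2 (W x a)
       - log2 (margA Q a) - log2 (Q x a)) - log2 #|X|%:R)%:E.
Proof.
move=> Q0 QW; rewrite /objective mutual_infoE.
have -> : cond_div W Q = (\sum_x \sum_a Q x a *
    (log2 (Q x a) - log2 (margX Q x) - log2 (W x a)))%:E.
  rewrite /cond_div -sumEFin; apply: eq_bigr => x _.
  rewrite -sumEFin; apply: eq_bigr => a _.
  have [->|Qxa] := eqVneq (Q x a) 0; first by rewrite mul0r.
  have Wxa : W x a != 0 by apply: contra_neq Qxa; exact: QW.
  have h0 : 0 < Q x a by rewrite lt_def Qxa Q0.
  have h1 : 0 < W x a by rewrite lt_def Wxa W0.
  have h2 := margX_gt0 Q0 Qxa.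
  rewrite (negbTE Wxa) log2M ?invr_gt0 ?mulr_gt0 // log2V ?mulr_gt0 // log2M //.
  by rewrite opprD addrA.
rewrite -EFinM -EFinB; congr (_%:E).
rewrite addrAC; congr (_ - _); rewrite mulr_sumr -sumrB.
apply: eq_bigr => x _; rewrite mulr_sumr -sumrB.
by apply: eq_bigr => a _; ring.
Qed.

(** No summand of the divergence is [-oo], so a single [+oo] decides the sum. *)
Lemma objective_abscont (Q : X -> A -> R) x a :
  W x a = 0 -> Q x a != 0 -> objective W Q = -oo%E.
Proof.
move=> Wxa Qxa; rewrite /objective.
suff -> : cond_div W Q = +oo%E by rewrite gt0_muley ?lte_fin // addeNy.
apply/eqP; rewrite esum_eqy; last first.
  move=> y _; apply/eqP => /eqP; rewrite esum_eqNy => /existsP[b /=].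
  by case: ifP => // _; case: ifP.
apply/existsP; exists x => /=; rewrite esum_eqy; last first.
  by move=> b _; case: ifP => // _; case: ifP.
by apply/existsP; exists a; rewrite (negbTE Qxa) Wxa eqxx.
Qed.

Context (p : X -> R) (q : A -> R) (K : R).
Hypotheses (p0 : forall x, 0 <= p x) (p1 : \sum_x p x = 1).
Hypotheses (q0 : forall a, 0 <= q a) (q1 : \sum_a q a = 1).
Hypotheses (K0 : 0 < K) (qW : forall x a, q a = 0 -> W x a = 0).
Hypothesis WK : forall x, \sum_a W x a ^+ 2 / q a <= K.
Hypothesis pWq : forall a, \sum_x p x * W x a ^+ 2 = K * q a ^+ 2.

(* Two applications of [ln t <= t - 1], to [t = Q_X W^2 / (q Q K)] and to
   [t = q / Q_A]. *)
Lemma objective_le (Q : X -> A -> R) : is_dist_XA Q ->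
  (objective W Q <= (log2 K - log2 #|X|%:R)%:E)%E.
Proof.
move=> [Q0 Q1].
have [/forallP QW|] := boolP [forall x, forall a, (W x a == 0) ==> (Q x a == 0)]; last first.
  move=> /forallPn[x /forallPn[a]]; rewrite negb_imply => /andP[/eqP Wxa Qxa].
  by rewrite (objective_abscont Wxa Qxa) leNye.
have {}QW x a : W x a = 0 -> Q x a = 0.
  by move=> Wxa; have /forallP /(_ a) := QW x; rewrite Wxa eqxx => /eqP.
rewrite objectiveE // lee_fin lerD2r /log2 ler_pdivlMr ?ln2_gt0 // mulr_suml.
(* Each of the two differences in [T] comes from one use of [ln t <= t - 1] and has a nonpositive
   total. *)
pose T x a := Q x a * ln K + (margX Q x * (W x a ^+ 2 / q a) / K - Q x a)
   + (Q x a * q a / margA Q a - Q x a).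
apply: (@le_trans _ _ (\sum_x \sum_a T x a)).
  apply: ler_sum => x _; rewrite mulr_suml; apply: ler_sum => a _.
  rewrite /T; have [Qxa|Qxa] := eqVneq (Q x a) 0.
    rewrite Qxa !mul0r !subr0 addr0 add0r.
    by rewrite divr_ge0 ?(ltW K0) // mulr_ge0 ?divr_ge0 ?sqr_ge0 ?sumr_ge0.
  have Wxa : W x a != 0 by apply: contra_neq Qxa; exact: QW.
  have qa : q a != 0 by apply: contra_neq Wxa; exact: qW.
  have h0 : 0 < Q x a by rewrite lt_def Qxa Q0.
  have h1 : 0 < W x a by rewrite lt_def Wxa W0.
  have h2 := margX_gt0 Q0 Qxa.
  have h3 := margA_gt0 Q0 Qxa.
  have h4 : 0 < q a by rewrite lt_def qa q0.
  have l2 : ln (2 : R) != 0 by rewrite gt_eqF // ln2_gt0.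
  have g1 := @ln_le_subr1 R (q a / margA Q a) (divr_gt0 h4 h3).
  have dpos : 0 < q a * Q x a * K by rewrite !mulr_gt0.
  have npos : 0 < margX Q x * W x a ^+ 2 by rewrite mulr_gt0 // exprn_gt0.
  have g2 := @ln_le_subr1 R _ (divr_gt0 npos dpos).
  rewrite !ln_div ?posrE // !lnM ?posrE ?mulr_gt0 ?exprn_gt0 // in g1 g2.
  have g3 := lerD g1 g2.
  have -> : Q x a * ln K + (margX Q x * (W x a ^+ 2 / q a) / K - Q x a) +
    (Q x a * q a / margA Q a - Q x a) = Q x a * (ln K + (q a / margA Q a - 1 +
       (margX Q x * W x a ^+ 2 / (q a * Q x a * K) - 1))).
    by field; rewrite qa Qxa !gt_eqF.
  rewrite -[leLHS]mulrA ler_wpM2l //.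
  have -> : (ln (margX Q x) / ln 2 + 2 * (ln (W x a) / ln 2) - ln (margA Q a) / ln 2 -
     ln (Q x a) / ln 2) * ln 2 = ln (margX Q x) + 2 * ln (W x a) - ln (margA Q a) - ln (Q x a).
    by field.
  by move: g3; lra.
have S1 : \sum_x \sum_a margX Q x * (W x a ^+ 2 / q a) / K <= 1.
  rewrite -[leRHS]Q1; apply: ler_sum => x _.
  rewrite -mulr_suml -mulr_sumr -/(margX Q x) -[leRHS]mulr1 -mulrA ler_wpM2l ?sumr_ge0 //.
  by rewrite ler_pdivrMr // mul1r.
(* Columns with [margA Q a = 0] contribute 0 instead of [q a], so this is only an inequality. *)
have S2 : \sum_x \sum_a Q x a * q a / margA Q a <= 1.
  rewrite exchange_big /= -[leRHS]q1; apply: ler_sum => a _.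
  rewrite -mulr_suml -mulr_suml -/(margA Q a).
  have [->|ma] := eqVneq (margA Q a) 0; first by rewrite mul0r mul0r.
  by rewrite mulrAC divff // mul1r.
rewrite /T; under eq_bigr do rewrite !big_split /= !sumrN -mulr_suml.
by rewrite !big_split /= !sumrN -mulr_suml Q1; lra.
Qed.

(** Complementary slackness: the slacks are nonnegative and, by [pWq] and [q1], their [p]-average is
    zero. *)
Lemma optimizer_tight x : p x != 0 -> \sum_a W x a ^+ 2 / q a = K.
Proof.
move=> px.
have tot : \sum_y p y * (K - \sum_a W y a ^+ 2 / q a) = 0.
  under eq_bigr do rewrite mulrBr mulr_sumr.
  rewrite sumrB -mulr_suml p1 mul1r exchange_big /=.
  apply/eqP; rewrite subr_eq0 -[eqbLHS]mulr1 -q1 mulr_sumr; apply/eqP.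
  apply: eq_bigr => a _; under [RHS]eq_bigr do rewrite mulrA.
  rewrite -mulr_suml pWq; have [->|qa] := eqVneq (q a) 0; first by rewrite invr0 !mulr0.
  by field.
have := psumr_eq0P _ tot; move=> /(_ _ x isT) h.
have /eqP : p x * (K - \sum_a W x a ^+ 2 / q a) = 0.
  by apply: h => y _; rewrite mulr_ge0 ?subr_ge0.
by rewrite mulf_eq0 (negbTE px) subr_eq0 => /eqP.
Qed.

(** The marginals are [p], by [optimizer_tight], and [q], by [pWq]; hence on the support of [Q]
    every bracket in [objectiveE] equals [log2 K]. *)
Lemma objective_attained :
  exists Q, is_dist_XA Q /\ objective W Q = (log2 K - log2 #|X|%:R)%:E.
Proof.
pose Q x a := p x * (W x a ^+ 2 / q a) / K.
have Q0 x a : 0 <= Q x a.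
  by rewrite divr_ge0 ?(ltW K0) // mulr_ge0 // divr_ge0 // sqr_ge0.
have QX x : margX Q x = p x.
  rewrite /margX /Q -mulr_suml -mulr_sumr.
  have [->|px] := eqVneq (p x) 0; first by rewrite !mul0r.
  by rewrite optimizer_tight // mulfK // gt_eqF.
have QA a : margA Q a = q a.
  rewrite /margA /Q -mulr_suml; under eq_bigr do rewrite mulrA.
  rewrite -mulr_suml pWq; have [->|qa] := eqVneq (q a) 0; first by rewrite invr0 mulr0 mul0r.
  by field; rewrite qa gt_eqF.
have Q1 : \sum_x \sum_a Q x a = 1.
  by rewrite -[RHS]p1; apply: eq_bigr => x _; rewrite -QX.
exists Q; split => //; rewrite objectiveE //; last first.
  by move=> x a; rewrite /Q => ->; rewrite expr0n /= mul0r mulr0 mul0r.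
congr (_ - _)%:E; rewrite -[RHS]mul1r -[X in _ = X * _]Q1 mulr_suml; apply: eq_bigr => x _.
rewrite mulr_suml; apply: eq_bigr => a _.
have [->|Qxa] := eqVneq (Q x a) 0; first by rewrite !mul0r.
congr (_ * _); rewrite QX QA.
move: (Qxa); rewrite {1}/Q !mulf_eq0 !negb_or !invr_eq0 => /andP[/andP[px /andP[/andP[Wxa _] qa]] _].
have h0 : 0 < p x by rewrite lt_def px p0.
have h1 : 0 < W x a by rewrite lt_def Wxa W0.
have h2 : 0 < q a by rewrite lt_def qa q0.
rewrite /Q !log2M ?invr_gt0 ?mulr_gt0 ?invr_gt0 ?exprn_gt0 // !log2V //; ring.
Qed.

End Objective.

(** * Achievability *)

Definition memoryless (R : realType) (X A : finType) (W : X -> A -> R) n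
  (x : seqn X n) (a : seqn A n) : R := \prod_(i < n) W (x i) (a i).

Lemma sum_prod_seqn (R : realType) (A : finType) n (F : 'I_n -> A -> R) :
  \sum_(a : seqn A n) \prod_(i < n) F i (a i) = \prod_(i < n) \sum_a F i a.
Proof. by rewrite bigA_distr_bigA. Qed.

Lemma PnE (R : realType) (X A : finType) (W : X -> A -> R) n x a b :
  @Pn R X A W n x a b = #|X|%:R ^- n * (memoryless W x a * memoryless W x b).
Proof. by rewrite /Pn /memoryless big_split. Qed.

Lemma Pn_ge0 (R : realType) (X A : finType) (W : X -> A -> R) n x a b :
  (forall x a, 0 <= W x a) -> 0 <= @Pn R X A W n x a b.
Proof.
move=> W0; rewrite /Pn mulr_ge0 ?invr_ge0 ?exprn_ge0 ?ler0n //.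
by apply: prodr_ge0 => i _; rewrite mulr_ge0.
Qed.

Definition classical_value (R : realType) (X A : finType) (W : X -> A -> R) n
    (f g : {ffun seqn A n -> seqn X n}) : R :=
  \sum_(x : seqn X n) \sum_(a : seqn A n) \sum_(b : seqn A n)
     Pn W x a b * ((f a == x) && (g b == x))%:R.

Lemma classical_value_le (R : realType) (X A : finType) (W : X -> A -> R) n f g :
  @classical_value R X A W n f g <= omega_c W n.
Proof.
rewrite /omega_c.
apply: le_trans (le_bigmax_cond _ _ (isT : xpredT f)) => /=.
exact: (le_bigmax_cond _ (fun g => classical_value W f g) (isT : xpredT g)).
Qed.

(** Given [x], the outputs [a] and [b] are independent with the same law, so equal decoders succeed
    jointly with a squared probability. *)
Lemma classical_value_diag (R : realType) (X A : finType) (W : X -> A -> R) n f :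
  @classical_value R X A W n f f =
  #|X|%:R ^- n * \sum_x (\sum_(a | f a == x) memoryless W x a) ^+ 2.
Proof.
rewrite /classical_value mulr_sumr; apply: eq_bigr => x _.
rewrite expr2 big_distrlr /= mulr_sumr [RHS]big_mkcond /=.
apply: eq_bigr => a _; case: (f a == x); last first.
  by apply: big1 => b _; rewrite mulr0.
rewrite mulr_sumr [RHS]big_mkcond /=; apply: eq_bigr => b _.
by rewrite PnE; case: (f b == x); rewrite ?mulr1 ?mulr0.
Qed.

Lemma pigeonhole_sum (R : realType) (T : finType) (F : T -> R) (h : T -> nat) (N : nat) :
  (forall t, h t < N)%N -> \sum_t F t = 1 ->
  exists k : nat, N%:R^-1 <= \sum_(t | h t == k) F t.
Proof.
move=> hN F1.
have N0 : (0 < N)%N.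
  case: N hN => // hN; move: F1; rewrite big1 ?(elimF eqP)//.
    by move=> /eqP; rewrite eq_sym oner_eq0.
  by move=> t; have := hN t.
have [[k hk]|/forallNP hk] := pselect (exists k : nat, N%:R^-1 <= \sum_(t | h t == k) F t).
  by exists k.
exfalso.
have : \sum_t F t = \sum_(k < N) \sum_(t | h t == k) F t.
  rewrite (exchange_big_dep xpredT) //=; apply: eq_bigr => t _.
  rewrite (big_pred1 (Ordinal (hN t))) //.
have : \sum_(k < N) \sum_(t | h t == k) F t < \sum_(k < N) N%:R^-1.
  apply: ltr_sum; first by apply/hasP; exists (Ordinal N0); rewrite // mem_index_enum.
  by move=> k _; rewrite ltNge; apply/negP/hk.
rewrite sumr_const card_ord -[N%:R^-1 *+ N]mulr_natr mulVf ?pnatr_eq0 -?lt0n //.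
by move=> + E; rewrite -E F1 ltxx.
Qed.

Section LowerBound.
Context (R : realType) (X A : finType) (W : X -> A -> R).
Hypothesis W0 : forall x a, 0 <= W x a.
Context (p : X -> R) (q : A -> R) (K : R).
Hypotheses (p0 : forall x, 0 <= p x) (p1 : \sum_x p x = 1).
Hypotheses (q0 : forall a, 0 <= q a) (q1 : \sum_a q a = 1).
Hypothesis K0 : 0 < K.
Hypothesis WK : forall x, \sum_a W x a ^+ 2 / q a <= K.
Hypothesis pWq : forall a, \sum_x p x * W x a ^+ 2 = K * q a ^+ 2.

(** The conditional law of the optimal joint law given [x]. Where [p x = 0] a row may sum to less
    than 1, so [V1] is an inequality and [pV] carries the weight [p x]. *)
Let V x a := W x a ^+ 2 / q a / K.

Let V0 x a : 0 <= V x a.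
Proof. by rewrite divr_ge0 ?(ltW K0) // divr_ge0 // sqr_ge0. Qed.

Let V1 x : \sum_a V x a <= 1.
Proof. by rewrite -mulr_suml ler_pdivrMr // mul1r. Qed.

Let pV x : \sum_a p x * V x a = p x.
Proof.
rewrite -mulr_sumr -mulr_suml; have [->|px] := eqVneq (p x) 0; first by rewrite mul0r.
by rewrite (optimizer_tight p0 p1 q1 WK pWq) // divff ?mulr1 // gt_eqF.
Qed.

Let Vq a : \sum_x p x * V x a = q a.
Proof.
under eq_bigr do rewrite /V -mulrA mulrA.
rewrite -mulr_suml pWq; have [->|qa] := eqVneq (q a) 0; first by rewrite expr0n mulr0 mul0r.
by field; rewrite qa gt_eqF.
Qed.

Let VqW x a : V x a != 0 -> 0 < V x a /\ 0 < q a.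
Proof.
move=> Vxa; rewrite lt_def Vxa V0; split => //.
rewrite lt_def q0 andbT; apply: contra_neq Vxa => qa.
by rewrite /V qa invr0 mulr0 mul0r.
Qed.

(** The range [[- n B, n B]] of the information density [s] is covered by [N] windows of width
    [n * eps], with [N] independent of [n]; hence so is [c]. In window [k] one has [tau ^ 2 / theta
    = K ^ n * expR (- n * eps)]: the index [k] cancels. *)
Lemma omega_c_ge (x0 : X) (eps : R) : 0 < eps ->
  exists2 c : R, 0 < c & forall n, (0 < n)%N ->
    c * (#|X|%:R ^- n * (K ^+ n * expR (- (eps * n%:R)))) <= omega_c W n.
Proof.
move=> eps0.
pose v x a := ln (V x a / q a).
pose B := \sum_x \sum_a `|v x a|.
have vB x a : `|v x a| <= B.
  rewrite /B (bigD1 x) //= (bigD1 a) //= -addrA lerDl addr_ge0 ?sumr_ge0 // => y _.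
  exact: sumr_ge0.
have B0 : 0 <= B by apply: sumr_ge0 => x _; exact: sumr_ge0.
pose N := (Num.truncn (2 * B / eps)).+1.
have N0 : 0 < N%:R :> R by rewrite ltr0n.
exists (8 * N%:R ^+ 3)^-1; first by rewrite invr_gt0 mulr_gt0 // exprn_gt0.
move=> n n0.
have n0' : 0 < n%:R :> R by rewrite ltr0n.
pose s (x : seqn X n) (a : seqn A n) := \sum_(i < n) v (x i) (a i).
have sB x a : `|s x a| <= n%:R * B.
  apply: le_trans (ler_norm_sum _ _ _) _.
  apply: le_trans (ler_sum _ (fun i _ => vB (x i) (a i))) _.
  by rewrite sumr_const card_ord mulr_natl.
pose r x a := (s x a + n%:R * B) / (eps * n%:R).
have r0 x a : 0 <= r x a.
  rewrite divr_ge0 ?(ltW (mulr_gt0 eps0 n0')) //.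
  by have := sB x a; rewrite ler_norml => /andP[]; lra.
have r1 x a : r x a <= 2 * B / eps.
  rewrite /r ler_pdivrMr ?mulr_gt0 // mulrA divfK ?gt_eqF //.
  by have := sB x a; rewrite ler_norml => /andP[]; lra.
pose h (xa : seqn X n * seqn A n) := Num.truncn (r xa.1 xa.2).
have hN t : (h t < N)%N by rewrite ltnS; apply: le_truncn.
pose pn (x : seqn X n) := \prod_(i < n) p (x i).
pose qn (a : seqn A n) := \prod_(i < n) q (a i).
pose Vn := memoryless V (n := n).
pose Wn := memoryless W (n := n).
have pn0 x : 0 <= pn x by exact: prodr_ge0.
have Vn0 x a : 0 <= Vn x a by exact: prodr_ge0.
have Wn0 x a : 0 <= Wn x a by exact: prodr_ge0.
have pn1 : \sum_x pn x = 1.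
  by rewrite /pn (sum_prod_seqn (fun=> p)) big1.
have pVn : \sum_x \sum_a pn x * Vn x a = 1.
  rewrite -[RHS]pn1; apply: eq_bigr => x _.
  under eq_bigr do rewrite /pn /Vn /memoryless -big_split /=.
  rewrite (sum_prod_seqn (fun i b => p (x i) * V (x i) b)).
  by apply: eq_bigr => i _; exact: pV.
have [k hk] : exists k, N%:R^-1 <= \sum_(t | h t == k) pn t.1 * Vn t.1 t.2.
  apply: pigeonhole_sum => //.
  by rewrite -(pair_bigA _ (fun x a => pn x * Vn x a)).
(* Requiring [Vn x a != 0] makes every logarithm in [s x a] one of a positive real, and discards no
   mass. *)
pose G x a := (Vn x a != 0) && (h (x, a) == k).
pose theta := expR (n%:R * B - k%:R * (eps * n%:R)).
pose tau := Num.sqrt (K ^+ n * expR (n%:R * B - k.+1%:R * (eps * n%:R))).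
have Gs x a : G x a -> [/\ forall i, 0 < V (x i) (a i) /\ 0 < q (a i),
    k%:R * (eps * n%:R) - n%:R * B <= s x a
  & s x a <= k.+1%:R * (eps * n%:R) - n%:R * B].
  move=> /andP[Vxa /eqP hxa]; split.
  - move=> i; apply: VqW; apply: contra_neq Vxa => Vi.
    by rewrite /Vn /memoryless (bigD1 i) //= Vi mul0r.
  - rewrite lerBlDr -ler_pdivlMr ?mulr_gt0 // -/(r x a) -hxa.
    by have /andP[] := truncn_itv (r0 x a).
  - rewrite lerBrDr -ler_pdivrMr ?mulr_gt0 // -/(r x a) -hxa ltW //.
    by have /andP[] := truncn_itv (r0 x a).
have qVs x a : G x a -> qn a = expR (- s x a) * Vn x a.
  move=> /Gs[Vi _ _]; rewrite /s -sumrN expR_sum -big_split /=.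
  apply: eq_bigr => i _; have [h1 h2] := Vi i.
  rewrite expRN /v lnK ?posrE; last exact: divr_gt0.
  by rewrite invf_div divfK // gt_eqF.
have Gq : forall x a, G x a -> qn a <= theta * Vn x a.
  move=> x a Gxa; rewrite (qVs _ _ Gxa) ler_wpM2r // ler_expR.
  by have [_ + _] := Gs _ _ Gxa; lra.
have GW : forall x a, G x a -> tau * Vn x a <= Wn x a.
  move=> x a Gxa; have [Vi _ sk] := Gs _ _ Gxa.
  rewrite -ler_sqr ?nnegrE ?mulr_ge0 ?sqrtr_ge0 //.
  rewrite exprMn sqr_sqrtr; last by rewrite mulr_ge0 ?expR_ge0 // exprn_ge0 // ltW.
  (* Letter by letter this is [W ^ 2 = K * q * V], the definition of [V] where [q] is positive. *)
  have -> : Wn x a ^+ 2 = K ^+ n * (qn a * Vn x a).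
    rewrite -[n in K ^+ n]card_ord -prodr_const -!big_split /= -prodrXl /=.
    apply: eq_bigr => i _; have [_ h2] := Vi i.
    by rewrite /V; field; rewrite !gt_eqF.
  rewrite (qVs _ _ Gxa) expr2 !mulrA ler_wpM2r // ler_wpM2r // ler_wpM2l //.
    by rewrite exprn_ge0 // ltW.
  by rewrite ler_expR; lra.
have Vn1 x : \sum_a Vn x a <= 1.
  rewrite /Vn /memoryless (sum_prod_seqn (fun i => V (x i))).
  by apply: prodr_ile1 => i _; rewrite V1 sumr_ge0.
have pVq a : \sum_x pn x * Vn x a <= qn a.
  under eq_bigr do rewrite /pn /Vn /memoryless -big_split /=.
  rewrite (sum_prod_seqn (fun i x => p x * V x (a i))) le_eqVlt.
  by apply/orP; left; apply/eqP/eq_bigr => i _; exact: Vq.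
have Ggam : N%:R^-1 <= \sum_x \sum_(a | G x a) pn x * Vn x a.
  apply: le_trans hk _; rewrite big_mkcond /=.
  rewrite (eq_bigr (fun t => if h (t.1, t.2) == k then pn t.1 * Vn t.1 t.2 else 0)); last by case.
  rewrite -(pair_bigA _ (fun x a => if h (x, a) == k then pn x * Vn x a else 0)) /=.
  apply: ler_sum => x _; rewrite [leRHS]big_mkcond /=; apply: ler_sum => a _.
  by rewrite /G; have [->|] := eqVneq (Vn x a) 0; rewrite ?mulr0 /= ?if_same.
have N1 : N%:R^-1 <= 1 :> R by rewrite invf_le1 // ler1n.
have Ninv : 0 < N%:R^-1 :> R by rewrite invr_gt0.
have [f hf] := maximal_code [ffun=> x0] pn0 pn1 Vn0 Vn1 Wn0 pVq (expR_gt0 _) (sqrtr_ge0 _)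
  Ninv N1 Gq GW Ggam.
apply: le_trans (classical_value_le W f f); rewrite classical_value_diag.
rewrite mulrCA ler_wpM2l ?invr_ge0 ?exprn_ge0 //.
apply: le_trans hf.
rewrite sqr_sqrtr; last by rewrite mulr_ge0 ?expR_ge0 // exprn_ge0 // ltW.
have -> : expR (n%:R * B - k.+1%:R * (eps * n%:R)) = expR (- (eps * n%:R)) * theta.
  by rewrite -expRD; congr expR; rewrite -[k.+1]addn1 natrD; ring.
rewrite le_eqVlt; apply/orP; left; apply/eqP.
have simpl_ratio (Kn e th M : R) : 0 < th -> 0 < M ->
    Kn * (e * th) * M^-1 ^+ 3 / (8 * th) = (8 * M ^+ 3)^-1 * (Kn * e).
  by move=> th0 M0; field; rewrite !gt_eqF.
by rewrite simpl_ratio // expR_gt0.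
Qed.

End LowerBound.

(** * Quantum and no-signalling strategies *)

Section PositiveSemidefinite.
Context {R : realType}.
Local Notation C := R[i].

Lemma adjmxE m k (M : 'M[C]_(m, k)) : adjmx M = map_mx Num.conj M^T.
Proof. by rewrite /adjmx map_trmx. Qed.

Lemma adjmx_mul m k l (M : 'M[C]_(m, k)) (N : 'M[C]_(k, l)) :
  adjmx (M *m N) = adjmx N *m adjmx M.
Proof. by rewrite !adjmxE trmx_mul map_mxM. Qed.

Lemma adjmxK m k (M : 'M[C]_(m, k)) : adjmx (adjmx M) = M.
Proof. by apply/matrixP => i j; rewrite !mxE conjcK. Qed.

(** The entry is the quadratic form of [M] at the adjoint of row [i] of [B]. *)
Lemma psdmx_congr_diag_ge0 k m (M : 'M[C]_k) (B : 'M[C]_(m, k)) i :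
  psdmx M -> 0 <= (B *m M *m adjmx B) i i.
Proof.
move=> [_ /(_ (adjmx (row i B)))]; rewrite adjmxK.
suff -> : row i B *m M *m adjmx (row i B) = (B *m M *m adjmx B) i i *: 1%:M.
  by rewrite !mxE mulr1.
apply/matrixP => a b; rewrite !ord1 -row_mul !mxE mulr1.
by apply: eq_bigr => j _; rewrite !mxE.
Qed.

(** Diagonalize [M] by a unitary [P]. The eigenvalues are diagonal entries of [P *m M *m adjmx P],
    hence nonnegative, and their square roots give [B]. *)
Lemma psdmx_factor k (M : 'M[C]_k) : psdmx M -> exists B : 'M[C]_k, M = adjmx B *m B.
Proof.
move=> psdM; have [Mh _] := psdM.
have Mn : M \is normalmx by apply/normalmxP; rewrite -adjmxE Mh.
have := orthomx_spectralP Mn.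
set P := spectralmx M; set d := spectral_diag M => ME.
have Pu : P \is unitarymx by exact: spectral_unitarymx.
have PP : P *m adjmx P = 1%:M by rewrite adjmxE; apply/unitarymxP.
have {}ME : M = adjmx P *m diag_mx d *m P.
  by rewrite adjmxE -invmx_unitary.
have d0 i : 0 <= d 0 i.
  have := psdmx_congr_diag_ge0 P i psdM.
  rewrite ME !mulmxA PP mul1mx -mulmxA PP mulmx1.
  by rewrite !mxE eqxx mulr1n.
exists (diag_mx (map_mx sqrtC d) *m P).
rewrite adjmx_mul mulmxA -(mulmxA (adjmx P)).
suff -> : adjmx (diag_mx (map_mx sqrtC d)) *m diag_mx (map_mx sqrtC d) = diag_mx d by [].
rewrite adjmxE tr_diag_mx map_diag_mx mulmx_diag; congr diag_mx.
apply/rowP => i; rewrite !mxE.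
have s0 : 0 <= sqrtC (d 0 i) by rewrite sqrtC_ge0.
rewrite [X in X * _](geC0_conj s0).
by rewrite -expr2 sqrtCK.
Qed.

Lemma psdmx_trace_mul_ge0 k m (S : 'M[C]_k) (B : 'M[C]_(m, k)) :
  psdmx S -> 0 <= \tr (S *m (adjmx B *m B)).
Proof.
move=> psdS; rewrite mulmxA mxtrace_mulC mulmxA.
by apply: sumr_ge0 => i _; exact: psdmx_congr_diag_ge0.
Qed.

(** Factoring both operators writes their tensor product as [adjmx E *m E] with [E = B *t D], and
    the trace becomes that of [E *m S *m adjmx E]. *)
Lemma tensmx_trace_ge0 k l (S : 'M[C]_(k * l)) (M : 'M[C]_k) (N : 'M[C]_l) :
  psdmx S -> psdmx M -> psdmx N -> 0 <= \tr (S *m (M *t N)).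
Proof.
move=> psdS /psdmx_factor[B ->] /psdmx_factor[D ->].
rewrite -tensmx_mul.
have -> : adjmx B *t adjmx D = adjmx (B *t D).
  by apply/matrixP => i j; rewrite !mxE rmorphM.
exact: psdmx_trace_mul_ge0.
Qed.

Lemma tensmx_suml k l (T : finType) (M : T -> 'M[C]_k) (N : 'M[C]_l) :
  (\sum_t M t) *t N = \sum_t (M t *t N).
Proof.
apply/matrixP => i j; rewrite !mxE !summxE mulr_suml.
by apply: eq_bigr => t _; rewrite mxE.
Qed.

Lemma tensmx_sumr k l (T : finType) (M : 'M[C]_k) (N : T -> 'M[C]_l) :
  M *t (\sum_t N t) = \sum_t (M *t N t).
Proof.
apply/matrixP => i j; rewrite !mxE !summxE mulr_sumr.
by apply: eq_bigr => t _; rewrite mxE.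
Qed.

Lemma tensmx1 k l : (1%:M : 'M[C]_k) *t (1%:M : 'M[C]_l) = 1%:M.
Proof.
apply/matrixP => i j; case: (mxtens_indexP i) => i1 i2; case: (mxtens_indexP j) => j1 j2.
rewrite tensmxE !mxE (can_eq (@mxtens_indexK _ _)) xpair_eqE.
by case: (i1 == j1); case: (i2 == j2); rewrite ?mulr1 ?mulr0.
Qed.

Lemma Re_sum (T : finType) (F : T -> C) :
  complex.Re (\sum_t F t) = \sum_t complex.Re (F t).
Proof. by rewrite (big_morph _ (id1 := 0) (op1 := +%R)) //; case=> a b [c d]. Qed.

Lemma psdmx_scalar k (c : C) : 0 <= c -> psdmx (c%:M : 'M[C]_k).
Proof.
move=> c0; split.
  apply/matrixP => i j; rewrite !mxE [j == i]eq_sym; case: (i == j).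
    by rewrite !mulr1n; exact: geC0_conj.
  by rewrite !mulr0n conjc0.
move=> v; rewrite mul_mx_scalar -scalemxAl !mxE mulr_ge0 // sumr_ge0 // => i _.
by rewrite !mxE mulrC; exact: mul_conjC_ge0.
Qed.

End PositiveSemidefinite.

Section Values.
Context (R : realType) (X A : finType) (W : X -> A -> R).
Hypothesis W0 : forall x a, 0 <= W x a.

Definition ns_value n (Q : seqn A n -> seqn A n -> seqn X n -> seqn X n -> R) : R :=
  \sum_(x : seqn X n) \sum_(a : seqn A n) \sum_(b : seqn A n) Pn W x a b * Q a b x x.

(** Summing over one player's outcomes replaces that POVM by the identity, which erases the
    dependence on that player's input. *)
Lemma quantum_no_signalling n d (S : 'M[R[i]]_(d * d))
    (M N : seqn A n -> seqn X n -> 'M[R[i]]_d) :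
  density S -> (forall a, povm (M a)) -> (forall b, povm (N b)) ->
  no_signalling (fun a b y z => complex.Re (\tr (S *m (M a y *t N b z)))).
Proof.
move=> [psdS trS] povmM povmN.
have sumz a b y : \sum_z complex.Re (\tr (S *m (M a y *t N b z)))
    = complex.Re (\tr (S *m (M a y *t 1%:M))).
  by rewrite -Re_sum -raddf_sum -mulmx_sumr -tensmx_sumr; have [_ ->] := povmN b.
have sumy a b z : \sum_y complex.Re (\tr (S *m (M a y *t N b z)))
    = complex.Re (\tr (S *m (1%:M *t N b z))).
  by rewrite -Re_sum -raddf_sum -mulmx_sumr -tensmx_suml; have [_ ->] := povmM a.
split.
- move=> a b y z.
  have : 0 <= \tr (S *m (M a y *t N b z)).
    apply: tensmx_trace_ge0 => //; first by have [] := povmM a.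
    by have [] := povmN b.
  by rewrite lecE => /andP[].
- move=> a b; under eq_bigr do rewrite sumz.
  rewrite -Re_sum -raddf_sum -mulmx_sumr -tensmx_suml.
  by have [_ ->] := povmM a; rewrite tensmx1 mulmx1 /= trS.
- by move=> a a' b z; rewrite !sumy.
- by move=> a b b' y; rewrite !sumz.
Qed.

Lemma classical_value_quantum n (f g : {ffun seqn A n -> seqn X n}) :
  exists (d : nat) (S : 'M[R[i]]_(d.+1 * d.+1))
    (M N : seqn A n -> seqn X n -> 'M[R[i]]_(d.+1)),
    [/\ density S, (forall a, povm (M a)), (forall b, povm (N b))
      & classical_value W f g = qvalue W S M N].
Proof.
pose E (f : {ffun seqn A n -> seqn X n}) a x : 'M[R[i]]_1 := ((f a == x)%:R)%:M.
have povmE h a : povm (E h a).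
  split; first by move=> x; apply: psdmx_scalar; exact: ler0n.
  rewrite (bigD1 (h a)) //= big1 ?addr0; first by rewrite /E eqxx.
  by move=> x /negbTE hx; rewrite /E eq_sym hx; apply/matrixP => i j; rewrite !mxE mul0rn.
(* Here [0] encodes dimension 1: a deterministic decoder is a POVM of scalars 0 and 1. *)
exists 0%N, 1%:M, (E f), (E g); split => //.
  by split; [apply: psdmx_scalar; exact: ler01|rewrite mxtrace1].
apply: eq_bigr => x _; apply: eq_bigr => a _; apply: eq_bigr => b _; congr (_ * _).
rewrite mul1mx /mxtrace.
rewrite (big_pred1 (mxtens_index (ord0, ord0))); last first.
  by move=> i; rewrite /= -val_eqE /=; case: i => -[].
rewrite tensmxE !mxE eqxx !mulr1n.
rewrite -natrM mulnb.
by case: (_ && _); rewrite ?mulr0n ?mulr1n.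
Qed.

Context (q : A -> R) (K : R).
Hypotheses (q0 : forall a, 0 <= q a) (q1 : \sum_a q a = 1).
Hypotheses (K0 : 0 < K) (qW : forall x a, q a = 0 -> W x a = 0).
Hypothesis WK : forall x, \sum_a W x a ^+ 2 / q a <= K.

Lemma ns_value_le n Q : no_signalling Q -> @ns_value n Q <= #|X|%:R ^- n * K ^+ n.
Proof.
move=> [Q0 Q1 Qb Qa].
have -> : ns_value Q = #|X|%:R ^- n *
    \sum_x \sum_a \sum_b memoryless W x a * memoryless W x b * Q a b x x.
  rewrite /ns_value mulr_sumr; apply: eq_bigr => x _.
  rewrite mulr_sumr; apply: eq_bigr => a _.
  rewrite mulr_sumr; apply: eq_bigr => b _.
  by rewrite PnE !mulrA.
rewrite ler_wpM2l ?invr_ge0 ?exprn_ge0 //.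
(* The marginals of [Q] are read at the inputs [(a, a)] and [(b, b)]; by no-signalling they are the
   same at [(a, b)]. *)
apply: (@diag_value_le _ _ _ _ (fun a : seqn A n => \prod_(i < n) q (a i)) _
  (fun a b x => Q a b x x) (fun a x => \sum_z Q a a x z) (fun b x => \sum_y Q b b y x)).
- by rewrite exprn_ge0 // ltW.
- by move=> x a; exact: prodr_ge0.
- by move=> a; exact: prodr_ge0.
- by rewrite (sum_prod_seqn (fun=> q)) big1.
- move=> x a /eqP; rewrite prodf_seq_eq0 => /hasP[i _ /= /eqP qi].
  by rewrite /memoryless (bigD1 i) //= (qW _ qi) mul0r.
- move=> x; rewrite /memoryless.
  under eq_bigr do rewrite -prodrXl -prodf_div.
  rewrite (sum_prod_seqn (fun i b => W (x i) b ^+ 2 / q b)).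
  rewrite -[n in K ^+ n]card_ord -prodr_const.
  apply: ler_prod => i _; rewrite WK andbT.
  by apply: sumr_ge0 => a _; rewrite divr_ge0 // sqr_ge0.
- move=> a b x; split => //.
    by rewrite (Qa a a b) (bigD1 x) //= lerDl sumr_ge0.
  by rewrite (Qb b a b) (bigD1 x) //= lerDl sumr_ge0.
- by move=> a; rewrite Q1.
- by move=> b; rewrite exchange_big /= Q1.
Qed.

Lemma omega_chain (x0 : X) n : [/\ omega_c W n <= omega_q W n,
  omega_q W n <= omega_ns W n & omega_ns W n <= #|X|%:R ^- n * K ^+ n].
Proof.
pose nsset := [set v : R | exists Q, no_signalling Q /\ v = @ns_value n Q].
pose qset := [set v : R | exists (d : nat) (S : 'M[R[i]]_(d.+1 * d.+1))
    (M N : seqn A n -> seqn X n -> 'M[R[i]]_(d.+1)),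
    [/\ density S, (forall a, povm (M a)), (forall b, povm (N b)) & v = qvalue W S M N]].
have qns : qset `<=` nsset.
  move=> v [d [S [M [N [dS pM pN ->]]]]].
  by eexists; split; first exact: (quantum_no_signalling dS pM pN).
have nsub : ubound nsset (#|X|%:R ^- n * K ^+ n).
  by move=> v [Q [nsQ ->]]; exact: ns_value_le.
have qsub : ubound qset (#|X|%:R ^- n * K ^+ n) by move=> v /qns; exact: nsub.
pose f0 : {ffun seqn A n -> seqn X n} := [ffun=> [ffun=> x0]].
have cq (f g : {ffun seqn A n -> seqn X n}) : qset (classical_value W f g).
  exact: classical_value_quantum.
have q_ne : qset !=set0.
  by exists (classical_value W f0 f0); exact: cq.
have ns_ne : nsset !=set0 by case: q_ne => v /qns ?; exists v.
have cle (f g : {ffun seqn A n -> seqn X n}) : classical_value W f g <= omega_q W n.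
  by apply: ub_le_sup; [exists (#|X|%:R ^- n * K ^+ n)|exact: cq].
(* The maxima in [omega_c] start from 0, so bounding them by [omega_q] also needs this. *)
have oq0 : 0 <= omega_q W n.
  apply: le_trans (cle f0 f0).
  apply: sumr_ge0 => x _; apply: sumr_ge0 => a _; apply: sumr_ge0 => b _.
  by rewrite mulr_ge0 // Pn_ge0.
split.
- by apply: bigmax_le => // f _; apply: bigmax_le => // g _; exact: cle.
- apply: ge_sup => // v /qns nsv.
  by apply: ub_le_sup => //; exists (#|X|%:R ^- n * K ^+ n).
- exact: ge_sup.
Qed.

End Values.

(** * The exponents *)

(** The factor [c] costs [ln c / n], which tends to 0, and the rate loss [eps] is arbitrary. *)
Lemma cvg_exponent (R : realType) (u : nat -> R) (kap : R) : 0 < kap ->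
  (forall eps : R, 0 < eps -> exists2 c : R, 0 < c &
     forall n, (0 < n)%N -> c * (kap ^+ n * expR (- (eps * n%:R))) <= u n) ->
  (forall n, u n <= kap ^+ n) ->
  (fun n => log2 (u n) / n%:R) @ \oo --> log2 kap.
Proof.
move=> kap0 ulo uhi; apply/cvgrPdist_le => eps eps0.
have l0 : 0 < ln (2 : R) := ln2_gt0 R.
(* Half of the tolerance pays for the exponential loss and half for [ln c]; the factor [ln 2]
   converts to base 2. *)
have [|c c0 hc] := ulo (eps * ln 2 / 2); first by rewrite divr_gt0 // mulr_gt0.
near=> n.
have n0 : (0 < n)%N by near: n; exact: nbhs_infty_gt.
have N0 : 0 < n%:R :> R by rewrite ltr0n.
have Nl : 2 * `|ln c| <= eps * ln 2 * n%:R.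
  rewrite mulrC -ler_pdivrMl ?mulr_gt0 //.
  by near: n; exact: nbhs_infty_ger.
have kn0 : 0 < kap ^+ n by rewrite exprn_gt0.
have lo0 : 0 < c * (kap ^+ n * expR (- (eps * ln 2 / 2 * n%:R))).
  by rewrite !mulr_gt0 // expR_gt0.
have un0 : 0 < u n by apply: lt_le_trans (hc n n0).
have U : ln (u n) <= ln kap *+ n by rewrite -lnXn // ler_ln ?posrE.
have Lo : ln c + (ln kap *+ n - eps * ln 2 / 2 * n%:R) <= ln (u n).
  have := hc n n0; rewrite -ler_ln ?posrE //.
  by rewrite !lnM ?posrE ?mulr_gt0 ?expR_gt0 // lnXn // expRK.
rewrite -(mulr_natr (ln kap)) in U Lo.
have -> : log2 kap - log2 (u n) / n%:R = (ln kap * n%:R - ln (u n)) / (ln 2 * n%:R).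
  by rewrite /log2; field; rewrite !gt_eqF.
rewrite ger0_norm; last first.
  by apply: divr_ge0; [rewrite subr_ge0; exact: U|exact: ltW (mulr_gt0 l0 N0)].
rewrite ler_pdivrMr ?mulr_gt0 //.
have := ler_norm (- ln c); rewrite normrN.
by move: Lo Nl; lra.
Unshelve. all: by end_near.
Qed.

Theorem mainTheorem2 (R : realType) (X A : finType) (W : X -> A -> R) :
  (0 < #|X|)%N -> is_channel W ->
  exists L : R,
    [/\ (fun n : nat => log2 (omega_c W n) / n%:R) @ \oo --> L,
        (fun n : nat => log2 (omega_q W n) / n%:R) @ \oo --> L,
        (fun n : nat => log2 (omega_ns W n) / n%:R) @ \oo --> L,
        (exists Q, is_dist_XA Q /\ objective W Q = L%:E)
      & (forall Q, is_dist_XA Q -> (objective W Q <= L%:E)%E)].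
Proof.
move=> X0 chW; have [W0 _] := chW.
have [p [q [K [[p0 p1] [q0 q1] [K0 qW] WK pWq]]]] := renyi_optimizer X0 chW.
have /card_gt0P[x0 _] := X0.
have X0' : 0 < #|X|%:R :> R by rewrite ltr0n.
have kap0 : 0 < K / #|X|%:R by rewrite divr_gt0.
have kapn n : (K / #|X|%:R) ^+ n = #|X|%:R ^- n * K ^+ n.
  by rewrite expr_div_n mulrC.
have LE : log2 (K / #|X|%:R) = log2 K - log2 #|X|%:R.
  by rewrite log2M ?invr_gt0 // log2V.
have chain n := omega_chain W0 q0 q1 K0 qW WK x0 n.
have lower (u : nat -> R) : (forall n, omega_c W n <= u n) -> forall eps : R, 0 < eps ->
    exists2 c : R, 0 < c & forall n, (0 < n)%N ->
      c * ((K / #|X|%:R) ^+ n * expR (- (eps * n%:R))) <= u n.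
  move=> cu eps eps0.
  have [c c0 hc] := omega_c_ge W0 p0 p1 q0 q1 K0 WK pWq x0 eps0.
  exists c => // n n0; apply: le_trans (cu n).
  by rewrite kapn -mulrA; exact: hc.
exists (log2 (K / #|X|%:R)); split.
- apply: cvg_exponent => // [|n]; first by apply: lower.
  by rewrite kapn; have [h1 h2 h3] := chain n; apply: le_trans h1 (le_trans h2 h3).
- apply: cvg_exponent => // [|n].
    by apply: lower => n; have [] := chain n.
  by rewrite kapn; have [h1 h2 h3] := chain n; apply: le_trans h2 h3.
- apply: cvg_exponent => // [|n].
    by apply: lower => n; have [h1 h2 h3] := chain n; apply: le_trans h1 h2.
  by rewrite kapn; have [] := chain n.
- by rewrite LE; exact: (objective_attained W0 p0 p1 q0 q1 K0 WK pWq).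
- by move=> Q; rewrite LE; exact: (objective_le W0 q0 q1 K0 qW WK).
Qed.
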